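(* For all $\beta\ge1$, $C>0$, $N\in\mathbb{N}$ and $m\in\mathbb{N}$, with $h_w=h_w(\beta)$ and $H_w=\left\lfloor\frac{1}{6\beta}\log N\right\rfloor$, $$\mathbb{P}_N^{\beta,h_w}\left(\left\{|\phi^{-1}(0)|\le CN^{4/3}\right\}\cap\left\{\left|\phi^{-1}([1,H_w-m])\right|\ge 2e^{-2\beta m}N^2\right\}\right)\le 2\exp\left(4\beta N+4\beta CN^{4/3}-\tfrac12e^{2\beta m}N^{4/3}\right).$$
   Context: For an integer $N\ge1$, $\Lambda_N=\{1,\dots,N\}^2\subset\mathbb{Z}^2$; $x\sim y$ means that $x,y$ are nearest neighbors in $\mathbb{Z}^2$; $\partial\Lambda_N=\{x\in\mathbb{Z}^2\setminus\Lambda_N:\exists y\in\Lambda_N,\ x\sim y\}$. Let $\mathbb{Z}_+=\{0,1,2,\dots\}$ and $\Omega_N=\mathbb{Z}_+^{\Lambda_N}$. For $\phi\in\Omega_N$ the Hamiltonian with zero boundary condition is $$\mathcal{H}_N(\phi)=\sum_{\{x,y\}\subset\Lambda_N,\ x\sim y}|\phi(x)-\phi(y)|+\sum_{x\in\Lambda_N,\ y\in\partial\Lambda_N,\ x\sim y}|\phi(x)|.$$ For $A\subset\mathbb{Z}$ or $A\subset\mathbb{R}$, $\phi^{-1}(A)=\{x\in\Lambda_N:\phi(x)\in A\}$, and $\phi^{-1}(k)=\phi^{-1}(\{k\})$; the interval $[1,H_w-m]$ is empty if $H_w-m<1$; $|\cdot|$ of a finite set is its cardinality. For $\beta>0$,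 $h\ge0$, the probability measure $\mathbb{P}_N^{\beta,h}$ on $\Omega_N$ is $$\mathbb{P}_N^{\beta,h}(\phi)=\frac{1}{\mathcal{Z}_N^{\beta,h}}\,e^{-\beta\mathcal{H}_N(\phi)+h|\phi^{-1}(0)|},\qquad \mathcal{Z}_N^{\beta,h}=\sum_{\phi\in\Omega_N}e^{-\beta\mathcal{H}_N(\phi)+h|\phi^{-1}(0)|}<\infty.$$ The critical pinning parameter is $h_w(\beta)=\log\left(\frac{e^{4\beta}}{e^{4\beta}-1}\right)$. $\mathbb{N}=\{1,2,\dots\}$. *)

(* Defs.v *)
From HB Require Import structures.
From mathcomp Require Import all_boot all_order all_algebra.
From mathcomp Require Import all_classical all_reals all_analysis.

Set Implicit Arguments.
Unset Strict Implicit.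
Unset Printing Implicit Defensive.
Import Order.TTheory GRing.Theory Num.Theory.
Local Open Scope ring_scope.

(* {0, ..., N + 1}^2, as a finite window of Z^2: it contains {1, ..., N}^2
   together with all its nearest neighbours, hence its whole outer boundary. *)
Definition box (N : nat) : finType := ('I_N.+2 * 'I_N.+2)%type.

Definition adj (N : nat) (x y : box N) : bool :=
  `|(x.1 : nat)%:Z - (y.1 : nat)%:Z| + `|(x.2 : nat)%:Z - (y.2 : nat)%:Z| == 1.

Definition Lambda (N : nat) : {set box N} :=
  [set x : box N | (1 <= x.1 <= N)%N && (1 <= x.2 <= N)%N].

Definition boundary (N : nat) : {set box N} :=
  [set x : box N | (x \notin Lambda N) && [exists y in Lambda N, adj x y]].

Definition site (N : nat) : finType := {x : box N | x \in Lambda N}.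

Definition Omega (N : nat) : Type := {ffun site N -> nat}.
HB.instance Definition _ (N : nat) := Countable.on (Omega N).
HB.instance Definition _ (N : nat) := isPointed.Build (Omega N) [ffun=> 0%N].
HB.instance Definition _ (N : nat) := @isMeasurable.Build default_measure_display
  (Omega N) discrete_measurable discrete_measurable0
  discrete_measurableC discrete_measurableU.

Section Model.
Context {R : realType}.

(* The first double sum meets each unordered pair {x, y} twice. *)
Definition hamiltonian (N : nat) (phi : Omega N) : R :=
  2^-1 * (\sum_(x : site N) \sum_(y : site N | adj (val x) (val y))
            `|(phi x)%:R - (phi y)%:R|)
  + \sum_(x : site N) \sum_(y in boundary N | adj (val x) y) `|(phi x)%:R|.

Definition level_set (N : nat) (phi : Omega N) (A : set int) :
    {set site N} := [set x : site N | (phi x)%:Z \in A].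

Definition weight (beta h : R) (N : nat) (phi : Omega N) : R :=
  expR (- beta * hamiltonian phi + h * #|level_set phi [set 0]%classic|%:R).

Definition partition_fun (beta h : R) (N : nat) : \bar R :=
  \esum_(phi in [set: Omega N]) (weight beta h phi)%:E.

(* For 0 < beta the partition function is finite (partition_fun_lty), so [fine]
   loses nothing and this is a probability measure (gibbs_setT). *)
Definition gibbs (beta h : R) (N : nat) (A : set (Omega N)) : \bar R :=
  \esum_(phi in A) (weight beta h phi / fine (partition_fun beta h N))%:E.

Definition h_w (beta : R) : R := ln (expR (4 * beta) / (expR (4 * beta) - 1)).

Definition H_w (beta : R) (N : nat) : int :=
  Num.floor ((6 * beta)^-1 * ln N%:R).

End Model.

Section Probability.
Context {R : realType}.
Implicit Types (beta h : R) (N : nat).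

Lemma hamiltonian_ge_edge N (phi : Omega N) (x y : site N) :
  adj (val x) (val y) ->
  `|(phi x)%:R - (phi y)%:R| <= 2 * hamiltonian phi :> R.
Proof.
move=> xy; rewrite /hamiltonian mulrDr mulrA divff// mul1r.
apply: ler_wpDr; first by rewrite mulr_ge0// sumr_ge0// => *; exact: sumr_ge0.
rewrite (bigD1 x)//= (bigD1 y)//= -!addrA lerDl addr_ge0//.
  exact: sumr_ge0.
by apply: sumr_ge0 => *; exact: sumr_ge0.
Qed.

Lemma hamiltonian_ge_boundary N (phi : Omega N) (x : site N) (y : box N) :
  y \in boundary N -> adj (val x) y -> (phi x)%:R <= hamiltonian phi :> R.
Proof.
move=> yb xy; rewrite /hamiltonian; apply: ler_wpDl.
  by rewrite mulr_ge0// ?invr_ge0// sumr_ge0// => *; exact: sumr_ge0.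
rewrite (bigD1 x)//= (bigD1 y) ?yb//= ger0_norm// -!addrA lerDl addr_ge0//.
  exact: sumr_ge0.
by apply: sumr_ge0 => *; exact: sumr_ge0.
Qed.

Lemma hamiltonian_ge0 N (phi : Omega N) : 0 <= hamiltonian phi :> R.
Proof.
by rewrite /hamiltonian addr_ge0 ?mulr_ge0 ?invr_ge0//;
  apply: sumr_ge0 => *; exact: sumr_ge0.
Qed.

Lemma height_le_hamiltonian N (phi : Omega N) (x : site N) :
  (phi x)%:R <= (2 * N)%:R * hamiltonian phi :> R.
Proof.
have xN : ((val x).1 <= N)%N.
  by have := valP x; rewrite inE => /andP[/andP[]].
apply: (@le_trans _ _ ((2 * (val x).1)%:R * hamiltonian phi)); last first.
  by rewrite ler_wpM2r ?hamiltonian_ge0// ler_nat leq_mul2l.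
clear xN.
have [j jx] : exists j, j = (val x).1 :> nat by exists (val x).1.
rewrite -jx; elim: j x jx => [|j IH] x xj.
  by move: (valP x); rewrite inE -xj.
have /[!inE] /andP[/andP[_ xN] xN2] := valP x.
have jN : (j < N.+2)%N.
  by rewrite (leq_trans _ (leqnSn _))// ltnS (leq_trans _ xN)// -xj.
pose y : box N := (Ordinal jN, (val x).2).
have xy : adj (val x) y.
  by rewrite /adj /= -xj subrr normr0 addr0 -addn1 PoszD addrAC subrr add0r normr1.
have [yL|yL] := boolP (y \in Lambda N).
  have := IH (Sub y yL : site N) erefl.
  have := @hamiltonian_ge_edge N phi x (Sub y yL) xy.
  rewrite ler_norml => /andP[_]; rewrite lerBlDr => /le_trans H1 H2.
  apply: H1; rewrite (le_trans (lerD (lexx _) H2))// -mulrDl.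
  by rewrite -natrD mulnS.
have yb : y \in boundary N.
  rewrite inE yL; apply/existsP; exists (val x); rewrite (valP x)/=.
  by rewrite /adj /= distrC (distrC ((val x).2 : nat)%:Z).
rewrite (le_trans (hamiltonian_ge_boundary _ yb xy))//.
by rewrite ler_peMl ?hamiltonian_ge0// ler1n muln_gt0.
Qed.

Lemma weight_ge0 beta h N (phi : Omega N) : 0 <= weight beta h phi.
Proof. exact: expR_ge0. Qed.

Lemma weight_le beta h N : 0 < beta ->
  exists K r : R, [/\ 0 <= K, 0 < r, r < 1 &
    forall phi : Omega N, weight beta h phi <= K * \prod_x r ^+ phi x].
Proof.
move=> beta0; set n := #|site N|.
pose d : R := (n * (2 * N)).+1%:R.
have d0 : 0 < d by rewrite ltr0n.
exists (expR (`|h| * n%:R)), (expR (- (beta / d))).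
split=> [| | |phi]; rewrite ?expR_ge0 ?expR_gt0//.
  by rewrite expR_lt1 oppr_lt0 divr_gt0.
have -> : \prod_(x : site N) expR (- (beta / d)) ^+ phi x
        = expR (- (beta / d) * \sum_x (phi x)%:R).
  by rewrite mulr_sumr expR_sum; apply: eq_bigr => x _; rewrite expRM_natr.
rewrite -expRD ler_expR addrC lerD//.
  rewrite (le_trans (ler_norm _))// normrM normr_nat ler_wpM2l// ler_nat.
  exact: max_card.
rewrite !mulNr lerN2 -mulrA ler_wpM2l ?(ltW beta0)// ler_pdivrMl//.
apply: (@le_trans _ _ (\sum_(x : site N) (2 * N)%:R * hamiltonian phi)).
  by apply: ler_sum => x _; exact: height_le_hamiltonian.
rewrite sumr_const -/n -[_ *+ _]mulr_natl mulrA -natrM.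
by rewrite ler_wpM2r ?hamiltonian_ge0// ler_nat.
Qed.

Lemma sum_geometric_le N (r : R) (s : seq (Omega N)) : 0 < r -> r < 1 ->
  uniq s -> \sum_(phi <- s) \prod_x r ^+ phi x <= (1 - r)^-1 ^+ #|site N|.
Proof.
move=> r0 r1 us.
pose M := \max_(phi <- s) \max_x phi x.
have leM phi x : phi \in s -> (phi x <= M)%N.
  move=> phis; apply: (@leq_trans (\max_x phi x)); first exact: leq_bigmax.
  exact: leq_bigmax_seq.
pose f (phi : Omega N) := [ffun x : site N => inord (phi x) : 'I_M.+1].
have fE phi x : phi \in s -> f phi x = phi x :> nat.
  by move=> /leM-/(_ x) ?; rewrite ffunE inordK.
have ufs : uniq (map f s).
  rewrite map_inj_in_uniq// => phi psi phis psis fpp.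
  by apply/ffunP => x; rewrite -fE// fpp fE.
rewrite (_ : \sum_(_ <- _) _ = \sum_(g <- map f s) \prod_x r ^+ g x); last first.
  rewrite big_map; apply: eq_big_seq => phi phis.
  by apply: eq_bigr => x _; rewrite fE.
rewrite big_uniq//=.
apply: (@le_trans _ _ (\sum_(g : {ffun site N -> 'I_M.+1}) \prod_x r ^+ g x)).
  rewrite big_mkcond/=; apply: ler_sum => g _; case: ifP => // _.
  by apply: prodr_ge0 => x _; rewrite exprn_ge0// ltW.
rewrite -(bigA_distr_bigA (fun _ (i : 'I_M.+1) => r ^+ i)) prodr_const.
rewrite lerXn2r ?nnegrE ?invr_ge0 ?subr_ge0 ?(ltW r1)//.
  by apply: sumr_ge0 => i _; rewrite exprn_ge0// ltW.
rewrite -[X in _ <= X]mul1r ler_pdivlMr ?subr_gt0// mulrC.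
have -> : (1 - r) * \sum_(i < M.+1) r ^+ i = 1 - r ^+ M.+1.
  by rewrite -opprB mulNr -subrX1 opprB.
by rewrite gerBl exprn_ge0// ltW.
Qed.

Lemma esumZl_le (T : choiceType) (c : R) (a : T -> R) : 0 < c ->
  (forall x, 0 <= a x) ->
  (\esum_(x in [set: T]) (c * a x)%:E
     <= c%:E * \esum_(x in [set: T]) (a x)%:E)%E.
Proof.
move=> c0 a0; apply: ge_ereal_sup => _ [X [finX _] <-].
rewrite fsbig_finite//= sumEFin -mulr_sumr EFinM lee_pmul2l//.
apply: ereal_sup_ubound; exists X; first by split.
by rewrite fsbig_finite//= sumEFin.
Qed.

Lemma partition_fun_lty beta h N : 0 < beta -> (partition_fun beta h N < +oo)%E.
Proof.
move=> /(@weight_le _ h N)[K [r [K0 r0 r1 wK]]].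
apply: (@le_lt_trans _ _ (K * (1 - r)^-1 ^+ #|site N|)%:E); last exact: ltry.
apply: ge_ereal_sup => _ [X [finX _] <-].
rewrite fsbig_finite// sumEFin lee_fin.
apply: (@le_trans _ _ (\sum_(phi <- finmap.enum_fset (fset_set X)) K * \prod_x r ^+ phi x)).
  by apply: ler_sum => phi _; exact: wK.
rewrite -mulr_sumr ler_wpM2l//; apply: sum_geometric_le => //.
exact: finmap.fset_uniq.
Qed.

Lemma partition_fun_gt0 beta h N : (0 < partition_fun beta h N)%E.
Proof.
apply: (@lt_le_trans _ _ (weight beta h ([ffun=> 0%N] : Omega N))%:E).
  by rewrite lte_fin expR_gt0.
apply: esum_ge; exists [set ([ffun=> 0%N] : Omega N)]%classic.
  by split => //; exact: finite_set1.
by rewrite fsbig_set1.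
Qed.

Section gibbs_measure.
Variables (beta h : R) (N : nat).
Local Open Scope ereal_scope.
Local Notation P := (@gibbs R beta h N).

Let density_ge0 (phi : Omega N) :
  0 <= (weight beta h phi / fine (partition_fun beta h N))%:E.
Proof.
by rewrite lee_fin divr_ge0 ?weight_ge0 ?fine_ge0// ltW// partition_fun_gt0.
Qed.

Let gibbs0 : P set0 = 0. Proof. exact: esum_set0. Qed.

Let gibbs_ge0 A : 0 <= P A. Proof. exact: esum_ge0. Qed.

Let gibbs_sigma_additive : semi_sigma_additive P.
Proof.
move=> F mF tF mUF; apply: cvg_toP.
  apply: ereal_nondecreasing_is_cvgn => a b ab.
  by apply: lee_sum_nneg_natr => // n _ _; exact: esum_ge0.
by rewrite /gibbs nneseries_sum_bigcup.
Qed.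

HB.instance Definition _ :=
  isMeasure.Build _ _ _ P gibbs0 gibbs_ge0 gibbs_sigma_additive.

Lemma gibbs_setT : (0 < beta)%R -> P [set: Omega N] = 1.
Proof.
move=> beta0; pose Z := partition_fun beta h N.
have Zfin : Z \is a fin_num.
  by rewrite ge0_fin_numE ?partition_fun_lty// ltW// partition_fun_gt0.
have z0 : (0 < fine Z)%R.
  by rewrite fine_gt0// partition_fun_gt0 partition_fun_lty.
have PE : P setT =
    \esum_(phi in [set: Omega N]) ((fine Z)^-1 * weight beta h phi)%:E.
  by apply: eq_esum => phi _; rewrite mulrC.
apply/eqP; rewrite eq_le; apply/andP; split.
  rewrite PE; apply: le_trans (esumZl_le _ _) _; rewrite ?invr_gt0//.
    by move=> phi; exact: weight_ge0.
  rewrite -/(partition_fun beta h N) -/Z -{2}(fineK Zfin) -EFinM.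
  by rewrite mulVf// gt_eqF.
rewrite -(@lee_pmul2l _ (fine Z)%:E) ?lte_fin// mule1 {1}fineK//.
have := @esumZl_le _ _ (fun phi : Omega N => (weight beta h phi / fine Z)%R) z0.
move=> /(_ (fun phi => divr_ge0 (weight_ge0 beta h phi) (ltW z0))).
move=> /(le_trans _); apply; rewrite le_eqVlt; apply/orP; left; apply/eqP.
by apply: eq_esum => phi _; rewrite mulrC divfK// gt_eqF.
Qed.

End gibbs_measure.

End Probability.

(* Main.v *)
(** Put q = exp(-4 beta) and K = H_w - m, so that exp(h_w) = 1 / (1 - q).
    Erase from phi an arbitrary subset of its sites of height in [1, K], i.e.
    lower them to 0.  Lowering a site of height k costs at most q^k and gains
    exp(h_w), so the weight of the new configuration psi is at least
    w(phi) q^k / (1 - q) per erased site.  Conversely, phi is restored from psi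
    by giving each zero of psi the height 0 with weight q and the height
    k in [1, K] with weight (1 - q) q^(K - k) / 2; these weights add up to at
    most 1.  The factor 1 - q cancels exp(h_w): an erased site contributes
    q^K / 2 whatever its height, and a kept zero contributes q.  Summing over
    the erased subset,
      sum over phi of w(phi) q^#(zeros) (1 + q^K / 2)^#(low sites) <= Z,
    and on the event the factor is at least the inverse of the claimed bound
    since q^K >= exp(4 beta m) N^(-2/3). *)

Require Import Defs.
From HB Require Import structures.
From mathcomp Require Import all_boot all_order all_algebra.
From mathcomp Require Import all_classical all_reals all_analysis.
From mathcomp Require Import ring lra zify.

Import Order.TTheory GRing.Theory Num.Theory.
Local Open Scope classical_set_scope.
Local Open Scope ring_scope.

(** * Lipschitz dependence of the Hamiltonian on the heights *)

Lemma degree_le N (x : site N) :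
  (#|[pred y : site N | adj (val x) (val y)]|
    + #|[pred y in boundary N | adj (val x) y]| <= 4)%N.
Proof.
have [x1 [x2 xE]] : exists x1 x2, val x = (x1, x2).
  by case: (val x) => x1 x2; exists x1, x2.
have := valP x; rewrite inE xE /= => /andP[/andP[a1 b1] /andP[a2 b2]].
(* Both coordinates lie in [[1, N]], so a shift by one stays in the window and every [inord] is
   exact. *)
pose s : seq (box N) := [:: (inord x1.+1, inord x2); (inord x1.-1, inord x2);
  (inord x1, inord x2.+1); (inord x1, inord x2.-1)].
have adj_s y : adj (x1, x2) y -> y \in s.
  case: y => y1 y2; rewrite !inE /adj /= => xy.
  have := ltn_ord y1; have := ltn_ord y2.
  by rewrite !xpair_eqE -!val_eqE /= !inordK; lia.
rewrite -(fintype.card_image val_inj) !cardE -size_cat (@uniq_leq_size _ _ s)//.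
  rewrite cat_uniq !enum_uniq andbT/=; apply/hasPn => y.
  rewrite !mem_enum inE => /andP[]; rewrite inE => /andP[yL _] _.
  by apply: contra yL => /fintype.imageP[z _ ->]; exact: (valP z).
move=> y; rewrite mem_cat !mem_enum => /orP[/fintype.imageP[z zx ->]|/andP[_]].
  by apply: adj_s; move: zx; rewrite inE.
exact: adj_s.
Qed.

Section Lipschitz.
Context {R : realType}.

(** By the triangle inequality an edge term changes by at most the height changes at its ends, and a
    site has at most four edges. *)
Lemma hamiltonian_le N (phi psi : Omega N) :
  hamiltonian psi <= hamiltonian phi
    + 4 * \sum_(x : site N) `|(phi x)%:R - (psi x)%:R| :> R.
Proof.
pose d (x : site N) : R := `|(phi x)%:R - (psi x)%:R|.
have d0 x : 0 <= d x by exact: normr_ge0.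
have inner : 2^-1 * (\sum_(x : site N) \sum_(y : site N | adj (val x) (val y))
    `|(psi x)%:R - (psi y)%:R|) <=
  2^-1 * (\sum_(x : site N) \sum_(y : site N | adj (val x) (val y))
    `|(phi x)%:R - (phi y)%:R|) +
  \sum_(x : site N) \sum_(y : site N | adj (val x) (val y)) d x :> R.
  (* An ordered pair is charged [d x + d y]. As [adj] is symmetric, both parts sum to [S], and the
     prefactor 1/2 leaves one [S]. *)
  set S := \sum_x \sum_(y | _) d x.
  have SE : S = \sum_(x : site N) \sum_(y : site N | adj (val x) (val y)) d y.
    rewrite /S (exchange_big_dep xpredT)//=; apply: eq_bigr => x _.
    by apply: eq_bigl => y; rewrite /adj distrC (distrC ((val y).2 : nat)%:Z).
  have -> : S = 2^-1 * (S + \sum_(x : site N)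
      \sum_(y : site N | adj (val x) (val y)) d y).
    by rewrite -SE; field.
  rewrite -mulrDr ler_wpM2l ?invr_ge0// -!big_split/=.
  apply: ler_sum => x _; rewrite -!big_split/=; apply: ler_sum => y _.
  have -> : (psi x)%:R - (psi y)%:R = ((phi x)%:R - (phi y)%:R) +
     (((psi x)%:R - (phi x)%:R) + ((phi y)%:R - (psi y)%:R)) :> R by ring.
  rewrite (le_trans (ler_normD _ _))// lerD2l (le_trans (ler_normD _ _))//.
  by rewrite distrC.
have outer : \sum_(x : site N) \sum_(y in boundary N | adj (val x) y)
    `|(psi x)%:R| <=
  \sum_(x : site N) \sum_(y in boundary N | adj (val x) y) `|(phi x)%:R| +
  \sum_(x : site N) \sum_(y in boundary N | adj (val x) y) d x :> R.
  rewrite -big_split/=; apply: ler_sum => x _.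
  rewrite -big_split/=; apply: ler_sum => y _.
  have -> : (psi x)%:R = (phi x)%:R + ((psi x)%:R - (phi x)%:R) :> R by ring.
  by rewrite (le_trans (ler_normD _ _))// lerD2l distrC.
rewrite {1}/hamiltonian (le_trans (lerD inner outer))// addrACA lerD2l.
rewrite -big_split/= mulr_sumr; apply: ler_sum => x _.
rewrite !sumr_const -mulrnDr -[_ *+ _]mulr_natl ler_wpM2r// ler_nat.
exact: degree_le.
Qed.

End Lipschitz.

(** * One-site kernels for erasing and restoring heights *)

Section Kernels.
Context {R : realType} (q : R) (K : nat).

(* In both kernels [a] is the height in phi and [b] the height in psi. *)
Definition erase (a b : nat) : R :=
  if a == b then (if a == 0%N then q else 1)
  else if (b == 0%N) && (a <= K)%N then q ^+ K / 2 else 0.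

Definition restore (a b : nat) : R :=
  if b == 0%N then
    (if a == 0%N then q
     else if (a <= K)%N then (1 - q) / 2 * q ^+ (K - a) else 0)
  else (a == b)%:R.

Lemma restore_ge0 a b : 0 <= q <= 1 -> 0 <= restore a b.
Proof.
move=> /andP[q0 q1]; rewrite /restore; case: ifP => // _; case: ifP => // _.
by case: ifP => // _; rewrite mulr_ge0 ?exprn_ge0// divr_ge0// subr_ge0.
Qed.

Lemma erase_ge0 a b : 0 <= q -> 0 <= erase a b.
Proof.
move=> q0; rewrite /erase; case: ifP => _; first by case: ifP.
by case: ifP => // _; rewrite divr_ge0// exprn_ge0.
Qed.

Lemma erase_gt a b : (a < b)%N -> erase a b = 0.
Proof. by move=> ab; rewrite /erase ltn_eqF//; case: b ab. Qed.

Lemma sum_restore_le1 M b : 0 <= q <= 2^-1 ->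
  \sum_(a < M.+1) restore a b <= 1.
Proof.
move=> /andP[q0 q1]; rewrite /restore; case: eqP => _; last first.
  rewrite -natr_sum -[1](mulr1n 1) ler_nat.
  have [bM|bM] := ltnP b M.+1; last first.
    by rewrite big1// => a _; apply/eqP; rewrite eqb0 ltn_eqF// (leq_trans _ bM).
  rewrite (bigD1 (Ordinal bM))//= eqxx big1 ?addn0// => a ab.
  by apply/eqP; rewrite eqb0; apply: contra ab.
(* For [b = 0] the bound is strengthened so that induction on [M] telescopes: the term at
   [M.+1 <= K] is half of [q ^+ (K - M.+1) - q ^+ (K - M)]. For [M >= K] truncated subtraction gives
   [q + 1/2], which is where [q <= 1/2] enters. *)
suff : \sum_(a < M.+1) (if a == 0%N :> nat then q else
    if (a <= K)%N then (1 - q) / 2 * q ^+ (K - a) else 0)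
    <= q + 2^-1 * q ^+ (K - M).
  move=> /le_trans; apply.
  have : q ^+ (K - M) <= 1 by rewrite exprn_ile1//; lra.
  lra.
elim: M => [|M IH]; first by rewrite big_ord1/= lerDl mulr_ge0// exprn_ge0.
rewrite big_ord_recr/= (le_trans (lerD IH (lexx _)))//.
have [MK|MK] := leqP M.+1 K; last first.
  by rewrite addr0 (eqP (MK : (K - M)%N == 0%N)) (eqP (ltnW MK : (K - M.+1)%N == 0%N)).
rewrite -(subnSK MK) exprS le_eqVlt; apply/orP; left; apply/eqP.
by field.
Qed.

(** A height can only stay or, when low and nonzero, drop to 0; [a <= M] keeps both targets in
    range. *)
Lemma sum_erase M a : (a <= M)%N -> \sum_(b < M.+1) erase a b =
  q ^+ (a == 0%N) * (1 + q ^+ K / 2) ^+ (0 < a <= K)%N.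
Proof.
move=> aM; rewrite /erase (bigD1 ord0)//=; case: a aM => [|a] aM /=.
  rewrite big1 ?addr0 ?expr1 ?expr0 ?mulr1// => b b0.
  have /negbTE b0' : (b : nat) != 0%N by [].
  by rewrite eq_sym b0'.
rewrite (bigD1 (Ordinal (aM : (a.+1 < M.+1)%N)))//= eqxx big1 => [|b]; last first.
  move=> /andP[b0 ba]; have /negbTE b0' : (b : nat) != 0%N by [].
  have /negbTE ba' : (b : nat) != a.+1 by [].
  by rewrite eq_sym ba' b0'.
by rewrite mul1r addr0 addrC; case: ltnP => _; rewrite ?expr1 ?expr0 ?addr0.
Qed.

(** Equality holds wherever [erase a b] is nonzero: for an erased site,
    [q ^+ a * q ^+ (K - a) = q ^+ K] and the factor [1 - q] of [restore] cancels the pinning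
    reward. *)
Lemma erase_le_restore a b : 0 < q -> q < 1 ->
  (1 - q)^-1 ^+ (a == 0%N) * erase a b
  <= q ^+ (a - b) * (1 - q)^-1 ^+ (b == 0%N) * restore a b.
Proof.
move=> q0 q1; have q1' : 0 < 1 - q by lra.
rewrite /erase; have [->|ab] := eqVneq a b.
  by rewrite subnn expr0 mul1r /restore eqxx; case: (b == 0%N).
case: ifPn => [/andP[/eqP b0 aK]|_]; last first.
  rewrite mulr0 !mulr_ge0 ?exprn_ge0 ?invr_ge0 ?(ltW q0) ?(ltW q1')//.
  by apply: restore_ge0; rewrite !ltW.
rewrite /restore b0 /=; have /negbTE a0 : a != 0%N by rewrite -b0.
rewrite a0 aK expr0 mul1r expr1 subn0 -{1}(subnK aK) exprD.
rewrite le_eqVlt; apply/orP; left; apply/eqP; field; lra.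
Qed.

End Kernels.

(** * Comparison of weights under erasure, and Markov's inequality *)

Section Transfer.
Context {R : realType}.
Context (beta h : R) (N K : nat).
Let q : R := expR (- (4 * beta)).
Context (beta_gt0 : 0 < beta) (hq : expR h = (1 - q)^-1).

Let q_gt0 : 0 < q. Proof. exact: expR_gt0. Qed.
Let q_lt1 : q < 1. Proof. by rewrite expR_lt1 oppr_lt0 mulr_gt0. Qed.

Lemma level_set0E (phi : Omega N) :
  #|level_set phi [set 0]| = (\sum_x (phi x == 0%N))%N.
Proof.
rewrite -sum1_card big_mkcond/=; apply: eq_bigr => x _.
have -> : (x \in level_set phi [set 0]) = (phi x == 0%N).
  by rewrite inE; apply/idP/eqP; rewrite inE /=; [case|move=> ->].
by case: eqP.
Qed.

Lemma weightE (phi : Omega N) : weight beta h phi =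
  expR (- beta * hamiltonian phi) * \prod_x (1 - q)^-1 ^+ (phi x == 0%N).
Proof.
by rewrite /weight expRD expRM_natr hq level_set0E expr_sum.
Qed.

(** Product of the one-site inequality over all sites; the powers [q ^+ (a - b)] pay for the change
    of energy through [hamiltonian_le]. *)
Lemma weight_transfer (phi psi : Omega N) :
  weight beta h phi * \prod_x erase q K (phi x) (psi x)
  <= weight beta h psi * \prod_x restore q K (phi x) (psi x).
Proof.
(* If [psi] exceeds [phi] somewhere, the left side vanishes; otherwise the truncated differences
   below are the absolute ones. *)
have [/forallP le|] := boolP [forall x, (psi x <= phi x)%N]; last first.
  rewrite negb_forall => /existsP[x]; rewrite -ltnNge => lt.
  rewrite [X in _ * X](bigD1 x)//= erase_gt// mul0r mulr0 mulr_ge0 ?weight_ge0//.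
  by rewrite prodr_ge0// => y _; apply: restore_ge0; rewrite !ltW.
rewrite !weightE -!mulrA -!big_split/=.
apply: (@le_trans _ _ (expR (- beta * hamiltonian phi) * (\prod_x q ^+ (phi x - psi x)
    * \prod_x ((1 - q)^-1 ^+ (psi x == 0%N) * restore q K (phi x) (psi x))))).
  rewrite ler_wpM2l ?expR_ge0// -big_split/=; apply: ler_prod => x _.
  rewrite mulr_ge0 ?erase_ge0 ?exprn_ge0 ?invr_ge0 ?subr_ge0 ?(ltW q_lt1) ?(ltW q_gt0)//=.
  by rewrite mulrA; exact: erase_le_restore.
rewrite mulrA ler_wpM2r//.
  apply: prodr_ge0 => x _; rewrite mulr_ge0 ?exprn_ge0 ?invr_ge0 ?subr_ge0 ?(ltW q_lt1)//.
  by apply: restore_ge0; rewrite !ltW.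
have -> : \prod_x q ^+ (phi x - psi x) = expR (- (4 * beta) *
    \sum_x `|(phi x)%:R - (psi x)%:R|).
  rewrite mulr_sumr expR_sum; apply: eq_bigr => x _.
  by rewrite -natrB// normr_nat expRM_natr.
rewrite -expRD ler_expR; have := ler_wpM2l (ltW beta_gt0) (@hamiltonian_le R N phi psi).
move: (hamiltonian phi) (hamiltonian psi) => H H'; lra.
Qed.

Lemma sum_weight_le (s : seq (Omega N)) : uniq s ->
  \sum_(phi <- s) weight beta h phi <= fine (partition_fun beta h N).
Proof.
move=> us; rewrite -lee_fin fineK; last first.
  by rewrite ge0_fin_numE ?partition_fun_lty// ltW// partition_fun_gt0.
apply: esum_ge; exists [set` s]; first by split => //; exact: finite_seq.
by rewrite -fsbig_seq// sumEFin.
Qed.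

(** The total mass that the product of [erase] kernels sends out of [phi], evaluated by
    [sum_erase]. *)
Definition reward (phi : Omega N) : R :=
  \prod_x (q ^+ (phi x == 0%N) * (1 + q ^+ K / 2) ^+ (0 < phi x <= K)%N).

Let heights M (g : {ffun site N -> 'I_M.+1}) : Omega N :=
  [ffun x => g x : nat].

(** Expand [reward] over targets [g'], transfer the weight to [g'], and exchange the sums: the
    [restore] mass into each [g'] is at most 1. The cap [M] makes both sums finite, so that products
    of sums expand. *)
Let sum_reward_bounded M : q <= 2^-1 ->
  \sum_(g : {ffun site N -> 'I_M.+1})
    weight beta h (heights M g) * reward (heights M g)
  <= \sum_(g : {ffun site N -> 'I_M.+1}) weight beta h (heights M g).
Proof.
move=> q2.
apply: (@le_trans _ _ (\sum_(g : {ffun site N -> 'I_M.+1})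
  \sum_(g' : {ffun site N -> 'I_M.+1})
    weight beta h (heights M g') * \prod_x restore q K (g x) (g' x))).
  apply: ler_sum => g _.
  have -> : reward (heights M g) = \prod_x \sum_(b < M.+1) erase q K (g x) b.
    by apply: eq_bigr => x _; rewrite sum_erase ?ffunE// -ltnS.
  rewrite bigA_distr_bigA mulr_sumr; apply: ler_sum => g' _.
  have := weight_transfer (heights M g) (heights M g').
  congr (_ * _ <= _ * _); apply: eq_bigr => x _; by rewrite !ffunE.
rewrite exchange_big/=; apply: ler_sum => g' _.
rewrite -mulr_sumr ler_piMr ?weight_ge0//.
rewrite -(bigA_distr_bigA (fun x (a : 'I_M.+1) => restore q K a (g' x))).
rewrite [leRHS](_ : 1 = \prod_(x : site N) 1); last by rewrite big1.
apply: ler_prod => x _; apply/andP; split.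
  by apply: sumr_ge0 => a _; apply: restore_ge0; rewrite !ltW.
by apply: sum_restore_le1; rewrite q2 ltW.
Qed.

Lemma sum_weight_reward_le (s : seq (Omega N)) : q <= 2^-1 -> uniq s ->
  \sum_(phi <- s) weight beta h phi * reward phi
    <= fine (partition_fun beta h N).
Proof.
move=> q2 us; pose M := \max_(phi <- s) \max_x phi x.
have leM phi x : phi \in s -> (phi x <= M)%N.
  move=> phis; apply: (@leq_trans (\max_x phi x)); first exact: leq_bigmax.
  exact: leq_bigmax_seq.
pose trunc (phi : Omega N) := [ffun x : site N => inord (phi x) : 'I_M.+1].
have truncK : {in s, cancel trunc (heights M)}.
  by move=> phi /leM phiM; apply/ffunP => x; rewrite !ffunE inordK// ltnS.
have heights_inj : injective (heights M).
  move=> g g' /ffunP gg'; apply/ffunP => x; apply: val_inj.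
  by have := gg' x; rewrite !ffunE.
have r0 phi : 0 <= weight beta h phi * reward phi.
  rewrite mulr_ge0 ?weight_ge0// prodr_ge0// => x _.
  by rewrite mulr_ge0 ?exprn_ge0 ?addr_ge0 ?divr_ge0 ?exprn_ge0// ltW.
have -> : \sum_(phi <- s) weight beta h phi * reward phi =
    \sum_(g <- map trunc s) weight beta h (heights M g) * reward (heights M g).
  by rewrite big_map; apply: eq_big_seq => phi phis; rewrite truncK.
rewrite big_uniq/=; last by rewrite map_inj_in_uniq//; exact: can_in_inj truncK.
apply: le_trans (@sum_weight_le (map (heights M) (index_enum _)) _); last first.
  by rewrite map_inj_uniq// index_enum_uniq.
rewrite big_map; apply: le_trans (sum_reward_bounded M q2).
by rewrite big_mkcond/=; apply: ler_sum => g _; case: ifP.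
Qed.

(** Markov's inequality for [reward], applied to each finite subset of [E]. *)
Lemma gibbs_le (E : set (Omega N)) (c : R) : q <= 2^-1 -> 0 <= c ->
  (forall phi, E phi -> 1 <= c * reward phi) -> (gibbs beta h E <= c%:E)%E.
Proof.
move=> q2 c0 Ec; have Z0 : 0 < fine (partition_fun beta h N).
  by rewrite fine_gt0// partition_fun_gt0 partition_fun_lty.
apply: ge_ereal_sup => _ [X [finX XE] <-].
rewrite fsbig_finite// sumEFin lee_fin -mulr_suml ler_pdivrMr//.
apply: (@le_trans _ _ (\sum_(phi <- finmap.enum_fset (fset_set X))
    c * (weight beta h phi * reward phi))).
  rewrite big_seq [leRHS]big_seq; apply: ler_sum => phi.
  rewrite in_fset_set// inE => /XE /Ec cphi.
  by rewrite mulrCA ler_peMr ?weight_ge0.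
by rewrite -mulr_sumr ler_wpM2l// sum_weight_reward_le// finmap.fset_uniq.
Qed.

Lemma rewardE (phi : Omega N) : reward phi =
  q ^+ #|level_set phi [set 0]|
  * (1 + q ^+ K / 2) ^+ #|level_set phi `[1, K%:Z]|.
Proof.
rewrite /reward big_split/= -!expr_sum level_set0E; congr (_ * _ ^+ _).
rewrite -[RHS]sum1_card [RHS]big_mkcond/=; apply: eq_bigr => x _.
have -> : (x \in level_set phi `[1, K%:Z]) = (0 < phi x <= K)%N.
  by rewrite inE; apply/idP/idP; rewrite inE /= in_itv /=; lia.
by case: ifP.
Qed.

End Transfer.

(** * Explicit estimates and the conclusion *)

Lemma expR_half_le (R : realType) (t : R) : 0 <= t <= 1 -> expR (t / 2) <= 1 + t.
Proof.
(* [expR (- (t / 2)) >= 1 - t / 2], and [(1 + t) * (1 - t / 2) >= 1] on [[0, 1]]. *)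
move=> /andP[t0 t1]; have := expR_ge1Dx (- (t / 2)); rewrite expRN => e.
have e0 := expR_gt0 (t / 2).
have : (1 - t / 2) * expR (t / 2) <= 1.
  by rewrite -ler_pdivlMr// mul1r.
nra.
Qed.

Lemma expR_h_w (R : realType) (beta : R) : 0 < beta ->
  expR (h_w beta) = (1 - expR (- (4 * beta)))^-1.
Proof.
move=> b0; have e1 : 1 < expR (4 * beta) by rewrite expR_gt1; lra.
rewrite /h_w lnK ?posrE ?divr_gt0 ?expR_gt0 ?subr_gt0// expRN.
by field; lra.
Qed.

(** With [ell = ln N], the bound on [K] gives [q ^+ K >= exp(4 beta m) N^(-2/3)]; multiplying by the
    number of low sites leaves the power [2 - 2/3 = 4/3]. One halving comes from [erase], the other
    from [expR_half_le]. *)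
Lemma low_site_gain (R : realType) (beta ell m K : R) : 0 < beta ->
  K <= (6 * beta)^-1 * ell - m ->
  2^-1 * expR (2 * beta * m) * expR (4 / 3 * ell)
  <= expR (- (4 * beta) * K) / 2 / 2 *
     (2 * expR (- 2 * beta * m) * expR (2 * ell)).
Proof.
move=> b0 HK.
have -> : expR (- (4 * beta) * K) / 2 / 2 *
     (2 * expR (- 2 * beta * m) * expR (2 * ell)) =
  2^-1 * (expR (- (4 * beta) * K) * (expR (- 2 * beta * m) * expR (2 * ell))).
  by field.
rewrite -mulrA ler_wpM2l ?invr_ge0// -!expRD ler_expR.
have : 4 * beta * K <= 4 * beta * ((6 * beta)^-1 * ell - m).
  by rewrite ler_wpM2l// mulr_ge0// ltW.
have -> : 4 * beta * ((6 * beta)^-1 * ell - m) =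
    2 / 3 * ell - 4 * beta * m by field; rewrite gt_eqF.
lra.
Qed.

Theorem proposition1p3 (R : realType) (beta C : R) (N m : nat)
  (beta_ge1 : 1 <= beta) (C_gt0 : 0 < C) (N_gt0 : (0 < N)%N) (m_gt0 : (0 < m)%N) :
  let few_zeros := [set phi : Omega N |
    #|level_set phi [set 0]|%:R <= C * N%:R `^ (4 / 3)] in
  let many_low := [set phi : Omega N |
    2 * expR (- 2 * beta * m%:R) * N%:R ^+ 2
      <= #|level_set phi `[1, H_w beta N - m%:Z]|%:R :> R] in
  let bound := 2 * expR (4 * beta * N%:R + 4 * beta * C * N%:R `^ (4 / 3)
    - 2^-1 * expR (2 * beta * m%:R) * N%:R `^ (4 / 3)) in
  (gibbs beta (h_w beta) (few_zeros `&` many_low) <= bound%:E)%E.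
Proof.
cbv zeta; set few := (X in (X `&` _)); set many := (X in (_ `&` X)).
have b0 : 0 < beta by lra.
have q2 : expR (- (4 * beta)) <= 2^-1.
  rewrite expRN lef_pV2 ?posrE ?expR_gt0//.
  by have := expR_ge1Dx (4 * beta); lra.
have n0 : (0 : R) < N%:R by rewrite ltr0n.
set ell : R := ln N%:R.
have NE : N%:R = expR ell by rewrite lnK.
have [[K KE]|K1] : (exists K : nat, H_w beta N - m%:Z = K%:Z) \/
    H_w beta N - m%:Z < 1.
- by case: (H_w beta N - m%:Z) => K; [left; exists K|right].
- apply: (@gibbs_le _ beta (h_w beta) N K) => //.
    exact: (expR_h_w _ _ b0).
  move=> phi [few_phi many_phi]; rewrite rewardE//.
  rewrite /few /= in few_phi.
  have {}many_phi : 2 * expR (- 2 * beta * m%:R) * N%:R ^+ 2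
      <= #|level_set phi `[1, K%:Z]|%:R :> R by rewrite -KE; exact: many_phi.
  set n := #|level_set phi [set 0]| in few_phi *.
  set l := #|level_set phi `[1, K%:Z]| in many_phi *.
  set q := expR (- (4 * beta)) in q2 *.
  have qE : q ^+ K = expR (- (4 * beta) * K%:R) by rewrite expRM_natr.
  have HK : K%:R <= (6 * beta)^-1 * ell - m%:R.
    rewrite lerBrDr -natrD (le_trans _ (floor_le _))//.
    rewrite -/(H_w beta N) -[(K + m)%N%:R]/((K + m)%N%:Z%:~R) ler_int PoszD.
    by rewrite -KE subrK.
  have zeros : expR (- (4 * beta * C * N%:R `^ (4 / 3))) <= q ^+ n.
    rewrite /q -expRM_natr ler_expR; nra.
  have low : expR (2^-1 * expR (2 * beta * m%:R) * N%:R `^ (4 / 3))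
      <= (1 + q ^+ K / 2) ^+ l.
    apply: (@le_trans _ _ (expR (q ^+ K / 2 / 2) ^+ l)); last first.
      rewrite lerXn2r ?nnegrE ?expR_ge0//.
        by rewrite addr_ge0// divr_ge0// exprn_ge0// expR_ge0.
      apply: expR_half_le.
      have q0 : 0 <= q ^+ K by rewrite exprn_ge0// expR_ge0.
      have q1 : q ^+ K <= 1.
        by rewrite exprn_ile1 ?expR_ge0// (le_trans q2)// invf_le1// ler1n.
      by clear -q0 q1; move: (q ^+ K) q0 q1 => u u0 u1; lra.
    rewrite -expRM_natr ler_expR.
    have -> : N%:R `^ (4 / 3) = expR (4 / 3 * ell) :> R by rewrite /powR gt_eqF.
    apply: le_trans (low_site_gain _ _ _ _ _ b0 HK) _; rewrite -qE.
    have -> : expR (2 * ell) = N%:R ^+ 2 :> R by rewrite NE -expRM_natl.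
    by apply: ler_wpM2l many_phi; rewrite !divr_ge0// exprn_ge0// expR_ge0.
  (* By [zeros] and [low], the reward cancels the last two terms of the exponent in the bound,
     leaving this quantity. *)
  apply: (@le_trans _ _ (2 * expR (4 * beta * N%:R))).
    have e1 : 1 <= expR (4 * beta * N%:R).
      by rewrite -expR0 ler_expR !mulr_ge0// ltW.
    by rewrite (le_trans e1)// ler_peMl ?expR_ge0// ler1n.
  rewrite -[leRHS]mulrA ler_pM2l// (le_trans _ (ler_wpM2l (expR_ge0 _) (ler_pM _ _ zeros low)))//.
  by rewrite -!expRD ler_expR [leRHS](_ : _ = 4 * beta * N%:R)//; ring.
(* The interval of low heights is empty while [many] demands a positive count, so the event is empty
   and any cutoff, here 0, will do. *)
- apply: (@gibbs_le _ beta (h_w beta) N 0%N) => //.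
    exact: (expR_h_w _ _ b0).
  move=> phi [_]; rewrite /many /= eq_card0.
    by rewrite leNgt !mulr_gt0 ?expR_gt0 ?exprn_gt0.
  move=> x; rewrite !inE; apply/negP; rewrite inE /= in_itv /=; lia.
Qed.
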